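(* Let $X\subset\mathbb{R}^d$ be compact and let $f\in\mathrm{PAff}(X;X)$ be a piecewise affine map. Then $$h_{\mathrm{top}}(f)\le \lambda^+(f)+H_{\mathrm{mult}}(f).$$
   Context: **Piecewise affine maps.** A piecewise affine map $(X,\mathcal Z,f)$, written $f\in\mathrm{PAff}(X;X)$, consists of a compact set $X\subset\mathbb{R}^d$, a finite collection $\mathcal Z$ of open, pairwise disjoint polytopes such that $X'=\bigcup_{Z\in\mathcal Z}Z$ is dense in $X$, and a map $f:X'\to X$ such that $f_Z:=f|_Z:Z\to X$ is affine for each $Z\in\mathcal Z$. The $f_Z$ are the affine components of $f$; the linear part of $f_Z$ is $f_Z'$, and $d_xf:=f_Z'$ for $x\in Z$. The map $f$ need not be defined on $X\setminus X'$. Put $U_n=\bigcap_{k=0}^{n-1}f^{-k}(X')$, the set of points where $f^n$ is defined; for $x\in U_n$, $d_xf^n$ is the corresponding product of linear parts along the orbit. $\mathcal Z^n$ denotes the continuity partition of $f^n$: the collection of all nonempty sets $Z_0\cap f^{-1}(Z_1)\cap\dots\cap f^{-(n-1)}(Z_{n-1})$ with $Z_i\in\mathcal Z$. **Topological entropy.** Let $d(\cdot,\cdot)$ be a metric defining the standard topology on $X$, $d_n^f(x,y)=\max_{0\le k<n}d(f^kx,f^ky)$, and let $S(d_n^f,\epsilon)$ be the minimal number of $d_n^f$-balls of radius $\epsilon$ needed to cover $U_n$. Then $h_{\mathrm{top}}(f)=\lim_{\epsilon\to0}\limsup_{n\to\infty}\frac1n\log S(d_n^f,\epsilon)$ (independent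 of the choice of metric). **Multiplicity entropy.** For $a\in X$, $\mathrm{mult}(\mathcal Z^n,a)=|\{Z\in\mathcal Z^n: a\in\bar Z\}|$, $\mathrm{mult}(\mathcal Z^n)=\sup_{a\in X}\mathrm{mult}(\mathcal Z^n,a)$, and $H_{\mathrm{mult}}(f)=\limsup_{n\to\infty}\frac1n\log\mathrm{mult}(\mathcal Z^n)$. **Expansion rate.** $\lambda^+(f)=\limsup_{n\to\infty}\sup_{x\in U_n}\frac1n\max_{0\le k\le d}\log\|\Lambda^kd_xf^n\|$, where $\Lambda^k$ is the $k$-th exterior power (with $\|\Lambda^0\|=1$) and norms are induced by the Euclidean norm. *)

(* Defs.v *)
From HB Require Import structures.
From mathcomp Require Import all_boot all_order all_algebra.
From mathcomp Require Import all_classical all_reals all_analysis.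

Set Implicit Arguments.
Unset Strict Implicit.
Unset Printing Implicit Defensive.

Import Order.TTheory GRing.Theory Num.Theory.
Import numFieldNormedType.Exports.

Local Open Scope classical_set_scope.
Local Open Scope ring_scope.

(* Points of R^d are row vectors and matrices act on the right, so the linear
   part of a composition f \o g is g' *m f'. *)

Section ExteriorPower.
Context {R : realType}.

Definition enorm n (v : 'rV[R]_n) : R := Num.sqrt (\sum_i v 0 i ^+ 2).

Definition opnorm m n (A : 'M[R]_(m, n)) : R :=
  sup [set enorm (v *m A) | v in [set v | enorm v <= 1]].

(* Exterior powers in coordinates: the k-th exterior power of R^d is identified
   with row vectors indexed by the multi-indices I = (i_1 < ... < i_k), I being
   the index of e_I = e_(i_1) /\ ... /\ e_(i_k). The inner product for which
   the e_I are orthonormal is the one induced by the Euclidean structure, so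
   its norm is enorm. *)
Definition multi_index (k d : nat) : finType :=
  {I : k.-tuple 'I_d | sorted ltn [seq val i | i <- I]}.

Definition wedge k d (v : 'I_k -> 'rV[R]_d) : 'rV[R]_#|multi_index k d| :=
  \row_J \det (\matrix_(a < k, b < k) v a 0 (tnth (val (enum_val J)) b)).

(* The linear map sending e_I to (e_(i_1) A) /\ ... /\ (e_(i_k) A). *)
Definition extpow k d (A : 'M[R]_d) : 'M[R]_#|multi_index k d| :=
  \matrix_I wedge (fun a : 'I_k => row (tnth (val (enum_val I)) a) A).

End ExteriorPower.

Section PiecewiseAffine.
Context {R : realType} {d : nat}.
Local Notation V := 'rV[R]_d.
Implicit Types (X W : set V) (Z : set (set V)) (f : V -> V) (n : nat).

Definition open_polytope W : Prop :=
  bounded_set W /\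
  exists (m : nat) (A : 'M[R]_(d, m)) (b : 'rV[R]_m),
    W = [set x | forall j, (x *m A) 0 j < b 0 j].

Definition affine_on f W (A : 'M[R]_d) (b : V) : Prop :=
  forall x, W x -> f x = x *m A + b.

Definition domain Z : set V := \bigcup_(W in Z) W.

(* f is total for convenience: its values outside domain Z are unconstrained,
   and nothing below depends on them. *)
Record PAff X Z f : Prop := {
  paff_compact : compact X ;
  paff_finite : finite_set Z ;
  paff_polytope : forall W, Z W -> open_polytope W ;
  paff_disjoint : trivIset Z id ;
  paff_sub : domain Z `<=` X ;
  paff_dense : X `<=` closure (domain Z) ;
  paff_maps : forall x, domain Z x -> X (f x) ;
  paff_affine : forall W, Z W -> exists A b, affine_on f W A b }.

(* The U_n of the usual notation; the orbit condition at times 0, ..., n-1 keeps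
   every iterate involved inside the domain. *)
Definition iter_domain Z f n : set V :=
  [set x | forall k, (k < n)%N -> domain Z (iter k f x)].

(* Uniquely determined when W is open and nonempty. *)
Definition linear_part f W : 'M[R]_d :=
  xget 0 [set A | exists b, affine_on f W A b].

Definition piece Z (x : V) : set V := xget set0 [set W | Z W /\ W x].

Definition dlin Z f (x : V) : 'M[R]_d := linear_part f (piece Z x).

Definition dlin_iter Z f n (x : V) : 'M[R]_d :=
  \prod_(k < n) dlin Z f (iter k f x).

Definition continuity_partition Z f n : set (set V) :=
  [set C | C !=set0 /\
    exists2 w : 'I_n -> set V, (forall k, Z (w k)) &
      C = [set x | forall k : 'I_n, w k (iter k f x)]].

(* Only the values of dist on X matter; nonnegativity follows from the triangle
   inequality. The last clause: dist induces on X the subspace topology. *)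
Record compatible_metric X (dist : V -> V -> R) : Prop := {
  dist_eq0 : forall x y, X x -> X y -> dist x y = 0 <-> x = y ;
  dist_sym : forall x y, X x -> X y -> dist x y = dist y x ;
  dist_triangle : forall x y z, X x -> X y -> X z ->
    dist x z <= dist x y + dist y z ;
  dist_nbhs : forall x (A : set V), X x ->
    within X (nbhs x) A <->
    exists2 e : R, 0 < e & forall y, X y -> dist x y < e -> A y }.

Definition dist_iter (dist : V -> V -> R) f n (x y : V) : R :=
  \big[Num.max/0]_(k < n) dist (iter k f x) (iter k f y).

(* Centers are taken in iter_domain Z f n, where dist_iter is defined. *)
Definition covering_number (dist : V -> V -> R) Z f n (e : R) : \bar R :=
  ereal_inf [set counting C | C in [set C : set V |
    C `<=` iter_domain Z f n /\
    iter_domain Z f n `<=`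
      \bigcup_(c in C) [set y | dist_iter dist f n c y < e]]].

Local Open Scope ereal_scope.

(* In the three growth rates below, lne 0 = -oo and the supremum over the empty
   set is -oo, so they all equal -oo when no long orbit stays in the domain.
   The term n = 0 is irrelevant to the upper limits. *)
Definition htop (dist : V -> V -> R) Z f : \bar R :=
  lim (limn_esup (fun n => (n%:R^-1)%:E * lne (covering_number dist Z f n e))
       @[e --> (0 : R)%R^'+]).

Definition mult_at (P : set (set V)) (a : V) : \bar R :=
  counting [set C | P C /\ closure C a].

Definition mult X (P : set (set V)) : \bar R :=
  ereal_sup [set mult_at P a | a in X].

Definition Hmult X Z f : \bar R :=
  limn_esup (fun n =>
    (n%:R^-1)%:E * lne (mult X (continuity_partition Z f n))).

Definition expansion_rate Z f : \bar R :=
  limn_esup (fun n => ereal_sup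
    [set (n%:R^-1)%:E *
         \big[maxe/-oo]_(k < d.+1) lne (opnorm (extpow k (dlin_iter Z f n x)))%:E
    | x in iter_domain Z f n]).

End PiecewiseAffine.

(* Main.v *)
(* The iterate g = f^n is affine on each piece of Z^n. A small set meets at most
   mult(Z^n) of these pieces, and the image under g of its trace on one of them
   is covered by O(max_k |Lambda^k d g|) sets of the same small diameter, with a
   constant depending only on the dimension. Hence the covering numbers of g grow
   at rate at most log mult(Z^n) + log max_k |Lambda^k d g| + O(1); dividing by n
   and letting n tend to infinity removes the constant.
   The bound on the image of a small set does not use singular values: it is
   obtained with a single minor of the linear part, which is an entry of an
   exterior power. *)

From mathcomp Require finmap.
Require Import Defs.
From mathcomp Require Import all_boot all_order all_algebra.
From mathcomp Require Import all_classical all_reals all_analysis.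
From mathcomp Require Import perm ring lra zify.

Set Implicit Arguments.
Unset Strict Implicit.
Unset Printing Implicit Defensive.

Import Order.TTheory GRing.Theory Num.Theory.
Import numFieldNormedType.Exports.

Local Open Scope classical_set_scope.
Local Open Scope ring_scope.

(** * Minors, exterior powers and coverings of linear images of the unit ball *)

Section Minors.
Context {R : realType}.

(** Schur complement of the pivot [A i j]: what Gaussian elimination leaves once row [i] and column
    [j] are removed. *)
Definition schur d (A : 'M[R]_d.+1) (i j : 'I_d.+1) : 'M[R]_d :=
  \matrix_(a, b) (A (lift i a) (lift j b)
                  - A (lift i a) j * A i (lift j b) / A i j).

(** Puts [i] in front of a selection among the other indices, so that the pivot row or column
    borders a minor of the Schur complement. *)
Definition lift_sel d k (i : 'I_d.+1) (s : 'I_k -> 'I_d) : 'I_k.+1 -> 'I_d.+1 :=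
  fun a => if unlift ord0 a is Some b then lift i (s b) else i.

(** Block LU factorization with [L] unit lower triangular. By iteration, successive pivots multiply
    up to a minor of the original matrix. *)
Lemma det_schur d k (A : 'M[R]_d.+1) i j (s t : 'I_k -> 'I_d) : A i j != 0 ->
  \det (mxsub (lift_sel i s) (lift_sel j t) A) =
  A i j * \det (mxsub s t (schur A i j)).
Proof.
move=> p0.
pose L : 'M[R]_(1 + k) :=
  block_mx 1%:M 0 (\col_a (A (lift i (s a)) j / A i j)) 1%:M.
pose U : 'M[R]_(1 + k) := block_mx (A i j)%:M (\row_b A i (lift j (t b))) 0
  (mxsub s t (schur A i j)).
have -> : mxsub (lift_sel i s) (lift_sel j t) A = L *m U :> 'M[R]_(1 + k, 1 + k).
  rewrite /L /U mulmx_block !mul1mx !mul0mx !addr0.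
  apply/matrixP => a b; rewrite [LHS]mxE /lift_sel.
  have E c : lift ord0 c = rshift 1 c by apply/val_inj.
  have E0 : ord0 = lshift k (ord0 : 'I_1) by apply/val_inj.
  case: (unliftP ord0 a) => [a' ->|->]; case: (unliftP ord0 b) => [b' ->|->].
  - by rewrite !E block_mxEdr !mxE !big_ord_recl !big_ord0 !mxE /=; field.
  - by rewrite E E0 block_mxEdl !mxE !big_ord_recl !big_ord0 !mxE /=; field.
  - by rewrite E E0 block_mxEur !mxE.
  - by rewrite E0 block_mxEul !mxE eqxx mulr1n.
by rewrite det_mulmx (@det_lblock _ 1) (@det_ublock _ 1) !det1 !mul1r det_scalar1.
Qed.

Lemma rV_norm_leP d (x : 'rV[R]_d) (r : R) : 0 <= r ->
  reflect (forall j, `|x 0 j| <= r) (`|x| <= r).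
Proof.
move=> r0; rewrite [`|x|]mx_normrE; apply: (iffP idP) => [h j|h].
  by apply: le_trans h; exact: (le_bigmax _ (fun ij => `|x ij.1 ij.2|) (0, j)).
by apply: bigmax_le => // -[i j] _ /=; rewrite ord1.
Qed.

Lemma compact_seq_cover d (K : set 'rV[R]_d) (e : R) : compact K -> 0 < e ->
  exists s : seq 'rV[R]_d,
    forall x, K x -> exists2 c, c \in s & `|x - c| <= e.
Proof.
move=> cK e0; move: cK; rewrite compact_cover => /(_ _ K (fun c => ball c e)).
case => [c _|x Kx|D _ KD].
- exact: ball_open.
- by exists x => //; exact: ballxx.
exists (finmap.enum_fset D) => x /KD [c cD xc]; exists c => //.
by move: xc; rewrite -ball_normE /= distrC => /ltW.
Qed.

Lemma box_cover d (r e : R) : 0 < e ->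
  exists s : seq 'rV[R]_d,
    forall x, `|x| <= r -> exists2 c, c \in s & `|x - c| <= e.
Proof.
move=> e0; apply: (compact_seq_cover (K := [set x | `|x| <= r])) => //.
apply: bounded_closed_compact.
  by exists r; split; [exact: num_real|move=> M rM x /= xr; exact: le_trans (ltW rM)].
have -> : [set x : 'rV[R]_d | `|x| <= r] = closed_ball_ Num.norm 0 r.
  by apply/seteqP; split => x; rewrite /closed_ball_ /= sub0r normrN.
exact: closed_closed_ball_.
Qed.

Definition unlift_row d (j : 'I_d.+1) (y : 'rV[R]_d) : 'rV[R]_d.+1 :=
  \row_b (if unlift j b is Some b' then y 0 b' else 0).

Lemma unlift_row_le d (j : 'I_d.+1) (y : 'rV[R]_d) (r : R) :
  `|y| <= r -> `|unlift_row j y| <= r.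
Proof.
move=> yr; have r0 : 0 <= r by exact: le_trans yr.
apply/rV_norm_leP => // b; rewrite mxE; case: unliftP => [b' _|_].
  by move/rV_norm_leP : yr; apply.
by rewrite normr0.
Qed.

(** One elimination step seen on images: coordinate [j] fixes the multiple of the pivot row, and the
    rest is the image of a shorter vector under the Schur complement. *)
Lemma mulmx_pivot d (A : 'M[R]_d.+1) i j (x : 'rV[R]_d.+1) : A i j != 0 ->
  x *m A = ((x *m A) 0 j / A i j) *: row i A +
           unlift_row j ((\row_a x 0 (lift i a)) *m schur A i j).
Proof.
move=> p0; apply/rowP => b; rewrite !mxE.
case: (unliftP j b) => [b' ->|->]; last by rewrite addr0 divfK.
rewrite !mxE !(bigD1_ord i) //=.
under [X in _ = _ + X]eq_bigr do rewrite !mxE mulrBr.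
rewrite sumrB.
have -> : \sum_(a < d) x 0 (lift i a) *
    (A (lift i a) j * A i (lift j b') / A i j) =
  (\sum_(a < d) x 0 (lift i a) * A (lift i a) j) * (A i (lift j b') / A i j).
  by rewrite mulr_suml; apply: eq_bigr => a _; field.
by field.
Qed.

Lemma mulmx_box d (A : 'M[R]_d) (x : 'rV[R]_d) (p : R) j :
  (forall i, `|A i j| <= p) -> `|x| <= 1 -> `|(x *m A) 0 j| <= d%:R * p.
Proof.
move=> Ap x1; rewrite mxE; apply: le_trans (ler_norm_sum _ _ _) _.
rewrite mulr_natl -[X in _ *+ X](card_ord d) -sumr_const; apply: ler_sum => i _.
rewrite normrM -[leRHS]mul1r ler_pM //.
by move/rV_norm_leP : x1; apply.
Qed.

(* Gaussian elimination with complete pivoting, stopped as soon as all entries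
   are at most 1 in absolute value. The coordinate along the row of the pivot p
   ranges over an interval of bounded length and is known up to rho / (2 |p|)
   from O(|p|) grid points; p being the largest entry, this determines the
   contribution of that row up to rho / 2. The product of the pivots is a minor. *)
Lemma minor_cover d (rho : R) : 0 < rho -> exists2 C : R, 1 <= C &
  forall A : 'M[R]_d, exists (k : nat) (s t : 'I_k -> 'I_d) (c : seq 'rV[R]_d),
    [/\ (k <= d)%N, 1 <= `|\det (mxsub s t A)|,
        (size c)%:R <= C * `|\det (mxsub s t A)| &
        forall x, `|x| <= 1 -> exists2 y, y \in c & `|x *m A - y| <= rho].
Proof.
elim: d rho => [|d IH] rho rho0.
  exists 1 => // A; exists 0%N, id, id, [:: 0].
  rewrite det_mx00 normr1; split=> // [|x _]; first by rewrite mul1r.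
  by exists 0; rewrite ?mem_head // [x]thinmx0 mul0mx subr0 normr0 ltW.
pose h := rho / 2; have h0 : 0 < h by rewrite divr_gt0.
have [C C1 HC] := IH h h0.
(* For a matrix with all entries at most 1 in absolute value, the image of the unit ball lies in a
   box of radius [d.+1], which [s0] covers. *)
have [s0 Hs0] := @box_cover d.+1 d.+1%:R rho rho0.
pose C2 : R := 2 * d.+1%:R / h + 1.
have C2ge : 1 <= C2 by rewrite lerDr divr_ge0 ?mulr_ge0 // ltW.
(* The first two terms serve the case without pivot, where the minor is the empty one. The last
   serves the induction: at most [C2 * |p|] grid values times [C] times a minor of the Schur
   complement. *)
exists (1 + (size s0)%:R + C2 * C).
  by rewrite -addrA lerDl addr_ge0 // mulr_ge0 //; lra.
move=> A.
pose q := [arg max_(q > (ord0, ord0) : 'I_d.+1 * 'I_d.+1) `|A q.1 q.2|]%O.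
have qmax a b : `|A a b| <= `|A q.1 q.2|.
  by rewrite /q; case: arg_maxP => //= m _ /(_ (a, b) isT).
case: (leP `|A q.1 q.2| 1) => [p1|p1].
  pose e (a : 'I_0) : 'I_d.+1 := ord0.
  exists 0%N, e, e, s0; rewrite det_mx00 normr1; split=> // [|x x1].
    rewrite mulr1 -addrA addrCA lerDl addr_ge0 // mulr_ge0 //; lra.
  apply: Hs0; apply/rV_norm_leP => // j; rewrite -[leRHS]mulr1.
  by apply: mulmx_box => // i; exact: le_trans (qmax _ _) p1.
move: q qmax p1 => [i j] /=; set p := A i j => pmax p1.
have p0 : 0 < `|p| by apply: lt_trans p1.
have pn0 : p != 0 by rewrite -normr_gt0.
have [k [s [t [c [kd D1 cD Hc]]]]] := HC (schur A i j).
pose u l : R := l%:R * (h / `|p|) - d.+1%:R.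
pose L := (Num.truncn (2 * d.+1%:R * `|p| / h)).+1.
exists k.+1, (lift_sel i s), (lift_sel j t),
  [seq u l *: row i A + unlift_row j y | l <- iota 0 L, y <- c].
rewrite det_schur // normrM; split=> [//||| x x1].
- by rewrite mulr_ege1 // ltW.
- rewrite size_allpairs size_iota natrM.
  (* Since [|p|] exceeds 1, the one additional grid value is absorbed by the [+ 1] in [C2]. *)
  have LC : L%:R <= C2 * `|p|.
    rewrite /L -natr1 /C2 [leRHS]mulrDl mul1r; apply: lerD; last exact: ltW.
    rewrite mulrAC truncn_le; apply: mulr_ge0 => //.
    by apply: divr_ge0; [exact: mulr_ge0|exact: ltW].
  apply: le_trans (ler_pM _ _ LC cD) _ => //.
  have : 0 <= `|p| * `|\det (mxsub s t (schur A i j))| by rewrite mulr_ge0.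
  set z := _ * `|_| => z0.
  rewrite [leLHS](_ : _ = C2 * C * z); last by rewrite /z -/p; ring.
  by rewrite ler_wpM2r // lerDr.
have x'1 : `|\row_a x 0 (lift i a)| <= 1.
  by apply/rV_norm_leP => // a; rewrite mxE; move/rV_norm_leP : x1; apply.
have [y yc Hy] := Hc _ x'1.
pose v := (x *m A) 0 j / p.
have v_le : `|v| <= d.+1%:R.
  by rewrite normrM normfV ler_pdivrMr //; apply: mulmx_box.
have v0 : 0 <= (v + d.+1%:R) * (`|p| / h).
  apply: mulr_ge0; last by rewrite divr_ge0 // ltW.
  by move: v_le; rewrite ler_norml => /andP[] ; lra.
pose l := Num.truncn ((v + d.+1%:R) * (`|p| / h)).
exists (u l *: row i A + unlift_row j y).
  apply: allpairs_f => //; rewrite mem_iota /= add0n ltnS.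
  apply: le_truncn; rewrite -mulrA ler_wpM2r //; first by rewrite divr_ge0 // ltW.
  by move: v_le; rewrite ler_norml => /andP[_]; lra.
have uv : `|v - u l| <= h / `|p|.
  have /andP[l1 l2] := truncn_itv v0; rewrite -/l in l1 l2.
  have hp : 0 < h / `|p| by rewrite divr_gt0.
  have E : v + d.+1%:R = (v + d.+1%:R) * (`|p| / h) * (h / `|p|).
    by rewrite -mulrA [X in _ * X](_ : _ = 1) ?mulr1 //; field; rewrite !gt_eqF.
  have e1 : l%:R * (h / `|p|) <= v + d.+1%:R by rewrite E ler_wpM2r // ltW.
  have e2 : v + d.+1%:R <= l.+1%:R * (h / `|p|) by rewrite E ler_wpM2r // ltW.
  rewrite -[l.+1%:R]natr1 mulrDl mul1r in e2.
  by rewrite /u ler_norml; apply/andP; split; lra.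
rewrite (mulmx_pivot (i := i) (j := j)) // -/p -/v.
have -> (w : 'rV[R]_d) : v *: row i A + unlift_row j w
    - (u l *: row i A + unlift_row j y)
  = (v - u l) *: row i A + unlift_row j (w - y).
  apply/rowP => b; rewrite !mxE; case: unliftP => [b' _|_]; rewrite ?mxE; ring.
apply: le_trans (ler_normD _ _) _; rewrite [rho](_ : _ = h + h); last first.
  by rewrite /h; field.
rewrite lerD //; last exact: unlift_row_le.
apply/rV_norm_leP; first exact: ltW.
move=> b; rewrite !mxE normrM.
apply: le_trans (ler_pM _ _ uv (pmax i b)) _ => //.
by rewrite divfK // gt_eqF.
Qed.

Lemma le_enorm n (v : 'rV[R]_n) j : `|v 0 j| <= enorm v.
Proof.
rewrite -sqrtr_sqr ler_wsqrtr // (bigD1 j) //= lerDl sumr_ge0 // => i _.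
exact: sqr_ge0.
Qed.

Lemma entry_le_opnorm m n (A : 'M[R]_(m, n)) i j : `|A i j| <= opnorm A.
Proof.
have -> : `|A i j| = `|(row i A) 0 j| by rewrite mxE.
apply: le_trans (le_enorm _ _) _; rewrite rowE.
apply: ub_le_sup; last first.
  exists (delta_mx 0 i) => //=; rewrite /enorm (bigD1 i) //= big1 => [|k ki].
    by rewrite mxE !eqxx addr0 expr1n sqrtr1.
  by rewrite mxE (negbTE ki) andbF expr0n.
(* [sup] dominates the members of a set only if the set is bounded above; this is an explicit
   bound. *)
exists (Num.sqrt (\sum_j (\sum_i `|A i j|) ^+ 2)) => _ [v /= v1 <-].
apply: ler_wsqrtr; apply: ler_sum => b _.
rewrite -[leLHS]real_normK ?num_real // ler_pXn2r ?nnegrE ?sumr_ge0 //.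
rewrite mxE; apply: le_trans (ler_norm_sum _ _ _) _; apply: ler_sum => a _.
rewrite normrM -[leRHS]mul1r ler_wpM2r //.
exact: le_trans (le_enorm _ _) v1.
Qed.

(** Pivots come in arbitrary order whereas multi-indices increase; sorting bridges the two at the
    cost of a permutation. *)
Lemma sort_index k d (s : 'I_k -> 'I_d) : injective s ->
  exists (p : {perm 'I_k}) (I : multi_index k d),
    forall a, s a = tnth (val I) (p a).
Proof.
move=> sI; pose le (a b : 'I_d) := (a <= b)%N.
pose T := [tuple s a | a < k].
have szT : size (sort le T) == k by rewrite size_sort size_tuple.
have Uq : uniq (sort le T) by rewrite sort_uniq map_inj_uniq ?enum_uniq.
have ST : sorted ltn [seq val i | i <- Tuple szT].
  rewrite ltn_sorted_uniq_leq (map_inj_uniq val_inj) Uq /= sorted_map.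
  by apply: sort_sorted => a b; exact: leq_total.
have /tuple_permP[p Hp] : perm_eq T (Tuple szT) by rewrite /= perm_sym perm_sort.
exists p, (exist _ (Tuple szT) ST) => a.
have := congr1 (fun r => nth (s a) r a) Hp.
by rewrite -!tnth_nth !tnth_mktuple.
Qed.

(** A repeated row or column would make the minor vanish, so both selections are injective. Sorting
    them changes only the sign, and the sorted minor is an entry of [extpow k A]. *)
Lemma minor_le_opnorm d k (A : 'M[R]_d) (s t : 'I_k -> 'I_d) :
  \det (mxsub s t A) != 0 -> `|\det (mxsub s t A)| <= opnorm (extpow k A).
Proof.
move=> D0.
have sI : injective s.
  move=> a b sab; apply/eqP; apply: contraNT D0 => ab; apply/eqP.
  by apply: (determinant_alternate ab) => j; rewrite !mxE sab.
have tI : injective t.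
  move=> a b tab; apply/eqP; apply: contraNT D0 => ab; apply/eqP.
  by rewrite -det_tr; apply: (determinant_alternate ab) => j; rewrite !mxE tab.
have [p [I sp]] := sort_index sI; have [q [J tq]] := sort_index tI.
have -> : mxsub s t A =
    row_perm p (col_perm q (mxsub (tnth (val I)) (tnth (val J)) A)).
  by apply/matrixP => a b; rewrite !mxE sp tq.
rewrite row_permE det_mulmx col_permE det_mulmx !det_perm !normrM.
rewrite !normrX !normrN !normr1 !expr1n mul1r mulr1.
have := entry_le_opnorm (extpow k A) (enum_rank I) (enum_rank J).
congr (`|_| <= _); rewrite !mxE; congr (\det _).
by apply/matrixP => a b; rewrite !mxE !enum_rankK.
Qed.

Lemma opnorm_extpow0 d (A : 'M[R]_d) : 1 <= opnorm (extpow 0 A).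
Proof.
have := @minor_le_opnorm d 0 A (widen_ord (leq0n d)) (widen_ord (leq0n d)).
by rewrite det_mx00 oner_neq0 normr1; apply.
Qed.

End Minors.

(** * Finite covers with a bound on their size *)

Section Coverable.
Context {T : Type} {R : realType}.
Implicit Types (good : set T -> Prop) (G : set T).

(** The bound [b] is real so that it can be multiplied by factors that are not integers; [good] will
    express dynamical smallness. *)
Definition coverable good (b : R) G : Prop := exists t : seq (set T),
  [/\ (size t)%:R <= b, forall x, G x -> exists2 A, A \in t & A x &
      forall A, A \in t -> good A].

Lemma coverable0 good b : 0 <= b -> coverable good b set0.
Proof. by move=> b0; exists [::]. Qed.

Lemma coverable_le good b b' G : b <= b' -> coverable good b G ->
  coverable good b' G.
Proof. by move=> bb' [t [tb tG tg]]; exists t; split=> //; exact: le_trans bb'. Qed.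

Lemma coverable_bigcup (I : eqType) (s : seq I) good b b' (H : I -> set T) G :
  0 <= b -> (size s)%:R <= b' -> (forall i, coverable good b (H i)) ->
  (forall x, G x -> exists2 i, i \in s & H i x) ->
  coverable good (b' * b) G.
Proof.
move=> b0 sb' Hb GH.
suff : coverable good ((size s)%:R * b) [set x | exists2 i, i \in s & H i x].
  move=> [t [tb tG tg]]; exists t; split=> // [|x Gx].
    by apply: le_trans tb _; exact: ler_wpM2r.
  exact/tG/GH.
elim: s {sb' GH} => [|i s [t [tb tG tg]]].
  by exists [::]; split=> // [|x []//]; rewrite mul0r.
have [u [ub uG ug]] := Hb i.
exists (u ++ t); split=> [|x /= [j]|A].
- by rewrite size_cat natrD /= -natr1 mulrDl mul1r addrC lerD.
- rewrite inE => /predU1P[-> Hx|js Hx].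
    by have [A Au Ax] := uG x Hx; exists A => //; rewrite mem_cat Au.
  have [|A At Ax] := tG x; first by exists j.
  by exists A => //; rewrite mem_cat At orbT.
- by rewrite mem_cat => /orP[/ug|/tg].
Qed.

End Coverable.

(** * Itineraries, and covers of small sets along orbits *)

Section Dynamics.
Context {R : realType} {d : nat}.
Local Notation V := 'rV[R]_d.
Variables (X : set V) (Z : set (set V)) (f : V -> V).
Hypothesis fX : PAff X Z f.

Local Notation U := (iter_domain Z f).

Lemma piece_spec x : domain Z x -> Z (piece Z x) /\ piece Z x x.
Proof.
move=> [W ZW Wx]; rewrite /piece; case: xgetP => [_ _ []//|/(_ W)].
by case; split.
Qed.

Lemma pieceE W x : Z W -> W x -> piece Z x = W.
Proof.
move=> ZW Wx; have [ZP Px] := @piece_spec x (ex_intro2 _ _ W ZW Wx).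
by apply: (paff_disjoint fX ZP ZW); exists x.
Qed.

Lemma dlin_sub x y : domain Z x -> domain Z y -> piece Z y = piece Z x ->
  f y - f x = (y - x) *m Defs.dlin Z f x.
Proof.
move=> /piece_spec[Zx Px] /piece_spec[_ Py] yx.
rewrite yx in Py; rewrite /Defs.dlin /linear_part.
case: xgetP => [A _ [b Ab]|noA].
  by rewrite (Ab _ Px) (Ab _ Py) opprD addrACA subrr addr0 mulmxBl.
by have [A [b Ab]] := paff_affine fX Zx; case: (noA A); exists b.
Qed.

Definition same_itinerary n x y : Prop :=
  [/\ U n x, U n y & forall k, (k < n)%N ->
      piece Z (iter k f y) = piece Z (iter k f x)].

Lemma same_itinerary_le m n x y : (m <= n)%N ->
  same_itinerary n x y -> same_itinerary m x y.
Proof.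
move=> mn [Ux Uy xy]; split=> k km.
- exact/Ux/leq_trans/mn.
- exact/Uy/leq_trans/mn.
- exact/xy/leq_trans/mn.
Qed.

Lemma iter_sub n x y : same_itinerary n x y ->
  iter n f y - iter n f x = (y - x) *m dlin_iter Z f n x.
Proof.
elim: n => [|n IH] xy; first by rewrite /dlin_iter big_ord0 mulmx1.
have -> : dlin_iter Z f n.+1 x = dlin_iter Z f n x *m Defs.dlin Z f (iter n f x).
  by rewrite /dlin_iter big_ord_recr.
rewrite mulmxA -IH; last first.
  exact: same_itinerary_le xy.
by case: xy => Ux Uy xy; rewrite -dlin_sub //=; [exact: Ux|exact: Uy|exact: xy].
Qed.

Lemma mulmx_lipschitz (A : 'M[R]_d) :
  exists2 L, 1 <= L & forall x : V, `|x *m A| <= L * `|x|.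
Proof.
exists (1 + \sum_i \sum_j `|A i j|) => [|x].
  by rewrite lerDl; apply: sumr_ge0 => i _; exact: sumr_ge0.
have S0 : 0 <= \sum_i \sum_j `|A i j|.
  by apply: sumr_ge0 => i _; exact: sumr_ge0.
apply/rV_norm_leP => [|j]; first by rewrite mulr_ge0 // addr_ge0.
rewrite mxE; apply: le_trans (ler_norm_sum _ _ _) _.
rewrite mulrDl mul1r; apply: ler_wpDl => //.
rewrite mulr_suml; apply: ler_sum => i _.
rewrite normrM mulrC ler_pM //; last by move/rV_norm_leP : (lexx `|x|); apply.
by rewrite (bigD1 j) //= lerDl sumr_ge0.
Qed.

(** There are finitely many linear parts, so one constant serves all pieces; [1 <= L] makes the
    powers of [L] monotone. *)
Lemma PAff_lipschitz : exists2 L, 1 <= L &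
  forall x y, domain Z x -> domain Z y -> piece Z y = piece Z x ->
  `|f y - f x| <= L * `|y - x|.
Proof.
have /finite_seqP[s Zs] := paff_finite fX.
have [L L1 HL] : exists2 L : R, 1 <= L &
    forall W, W \in s -> forall x : V, `|x *m linear_part f W| <= L * `|x|.
  elim: s {Zs} => [|W s [L L1 HL]]; first by exists 1.
  have [M M1 HM] := mulmx_lipschitz (linear_part f W).
  exists (Num.max L M) => [|W']; first by rewrite le_max L1.
  rewrite inE => /predU1P[-> x|/HL{}HL x].
    by apply: le_trans (HM x) _; rewrite ler_wpM2r // le_max lexx orbT.
  by apply: le_trans (HL x) _; rewrite ler_wpM2r // le_max lexx.
exists L => // x y Dx Dy xy; rewrite dlin_sub //; apply: HL.
by have [] := piece_spec Dx; rewrite Zs.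
Qed.

Lemma iter_lipschitz (L : R) n x y : 1 <= L ->
  (forall x y, domain Z x -> domain Z y -> piece Z y = piece Z x ->
    `|f y - f x| <= L * `|y - x|) ->
  same_itinerary n x y -> forall k, (k <= n)%N ->
  `|iter k f y - iter k f x| <= L ^+ n * `|y - x|.
Proof.
move=> L1 HL xy k kn.
have kL : `|iter k f y - iter k f x| <= L ^+ k * `|y - x|.
  elim: k kn => [|k IH] kn; first by rewrite expr0 mul1r.
  case: xy => Ux Uy xy; rewrite !iterS.
  apply: le_trans (HL _ _ _ _ _) _; [exact: Ux|exact: Uy|exact: xy|].
  by rewrite exprS -mulrA ler_wpM2l ?IH ?(ltnW kn) // (le_trans _ L1).
by apply: le_trans kL _; rewrite ler_wpM2r // ler_weXn2l.
Qed.

(** For [x] in [U n] this is the element of Z^n containing [x]; equality of cylinders sorts the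
    points by itinerary. *)
Definition cylinder n x : set V := [set y | same_itinerary n x y].

Lemma cylinder_refl n x : U n x -> cylinder n x x.
Proof. by []. Qed.

Lemma cylinder_partition n x : U n x ->
  continuity_partition Z f n (cylinder n x).
Proof.
move=> Ux; split; first by exists x; exact: cylinder_refl.
exists (fun k : 'I_n => piece Z (iter k f x)).
  by move=> k; have [] := piece_spec (Ux k (ltn_ord k)).
apply/seteqP; split => y /=.
  by move=> [_ Uy xy] k; rewrite -xy //; have [] := piece_spec (Uy k (ltn_ord k)).
move=> xy.
have Hk k (kn : (k < n)%N) : piece Z (iter k f x) (iter k f y).
  exact: xy (Ordinal kn).
have ZP k : (k < n)%N -> Z (piece Z (iter k f x)).
  by move=> kn; have [] := piece_spec (Ux k kn).
split=> // k kn.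
  by exists (piece Z (iter k f x)); [exact: ZP|exact: Hk].
by apply: pieceE; [exact: ZP|exact: Hk].
Qed.

(** An element of Z^n is determined by a word of length [n] over the finite alphabet [Z]. *)
Lemma partition_seq : exists K : nat, forall n, exists2 s : seq (set V),
  (size s <= K ^ n)%N & continuity_partition Z f n `<=` [set` s].
Proof.
have /finite_seqP[sZ Zs] := paff_finite fX.
exists (size sZ) => n.
suff [s sn Hs] : exists2 s : seq (set V), (size s <= size sZ ^ n)%N &
    forall w : 'I_n -> set V, (forall k, Z (w k)) ->
      [set x | forall k : 'I_n, w k (iter k f x)] \in s.
  by exists s => // C [_ [w Zw ->]]; exact: Hs.
elim: n => [|n [s sn Hs]].
  exists [:: setT] => // w _; rewrite inE; apply/eqP/seteqP; split=> // x _.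
  by case.
exists [seq C `&` (iter n f @^-1` W) | C <- s, W <- sZ].
  by rewrite size_allpairs expnS mulnC leq_mul.
move=> w Zw; apply/allpairsP.
exists ([set x | forall k : 'I_n, w (widen_ord (leqnSn n) k) (iter k f x)],
        w ord_max); split=> /=.
- by apply: (Hs (fun k => w (widen_ord (leqnSn n) k))).
- by have := Zw ord_max; rewrite Zs.
apply/seteqP; split=> x /=.
  by move=> wx; split=> [k|]; [exact: (wx (widen_ord _ k))|exact: (wx ord_max)].
move=> [wx wn] k; case: (ltnP k n) => kn.
  have := wx (Ordinal kn); congr (w _ _); exact/val_inj.
have -> : k = ord_max; last by [].
by apply/val_inj/eqP; rewrite eqn_leq kn -ltnS ltn_ord.
Qed.

Lemma iter_domainD m n x : U (m + n) x <-> U m x /\ U n (iter m f x).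
Proof.
split=> [Ux|[Ux Ux'] k kmn].
  split=> k kn; first by apply: Ux; rewrite ltn_addr.
  by rewrite -iterD; rewrite addnC; apply: Ux; rewrite ltn_add2l.
case: (ltnP k m) => km; first exact: Ux.
rewrite -(subnK km) iterD; apply: Ux'; lia.
Qed.

Lemma iter_domain_sub n k x : U n x -> (k < n)%N -> X (iter k f x).
Proof. by move=> Ux kn; apply: (paff_sub fX); exact: Ux. Qed.

(** Closeness is measured in the norm of R^d; the passage to [dist] is made later, by uniform
    continuity on [X]. *)
Definition shadowing N (delta : R) (A : set V) : Prop := forall x y, A x -> A y ->
  U N x /\ forall k, (k < N)%N -> `|iter k f x - iter k f y| <= delta.

(** Crude bound for fewer than a full block of iterates: split [B] by itinerary, into at most
    [K ^ q] parts, each of which spreads at most by the factor [L ^+ n]. *)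
Lemma cover_short (L delta r : R) (K q n : nat) (B : set V) :
  1 <= L -> (q <= n)%N -> L ^+ n * r <= delta ->
  (forall x y, domain Z x -> domain Z y -> piece Z y = piece Z x ->
    `|f y - f x| <= L * `|y - x|) ->
  (exists2 s : seq (set V),
    (size s <= K ^ q)%N & continuity_partition Z f q `<=` [set` s]) ->
  (forall x y, B x -> B y -> `|x - y| <= r) ->
  coverable (shadowing q delta) ((K ^ q)%:R : R) (B `&` U q).
Proof.
move=> L1 qn Lr HL [s sK Hs] Br.
exists [seq [set x | B x /\ (U q x /\ cylinder q x = C)] | C <- s].
split=> [|x [Bx Ux]|_ /mapP[C _ ->] x y].
- by rewrite size_map ler_nat.
- exists [set y | B y /\ (U q y /\ cylinder q y = cylinder q x)] => //.
  by apply/mapP; exists (cylinder q x) => //; exact/Hs/cylinder_partition.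
move=> [Bx [Ux xC]] [By [Uy yC]]; split=> // k kq.
have yx : same_itinerary q y x.
  by have := cylinder_refl Ux; rewrite xC -yC.
apply: le_trans (iter_lipschitz L1 HL yx (ltnW kq)) _.
apply: le_trans Lr; rewrite ler_pM ?Br ?exprn_ge0 ?(le_trans _ L1) //.
exact: ler_weXn2l.
Qed.

(** One block of [n] iterates. A set of diameter [r] meets at most [mu] elements of Z^n; on each of
    them the image under f^n is covered by [D] sets of diameter [r], to which the bound for [N]
    steps applies. Pulling back by f^n gives the cover for [n + N] steps. *)
Lemma cover_step (L delta r mu D b : R) (n N : nat) (B : set V) :
  (0 < n)%N -> 1 <= L -> 0 < r -> L ^+ n * r <= delta ->
  0 <= mu -> 0 <= D -> 0 <= b ->
  (forall x y, domain Z x -> domain Z y -> piece Z y = piece Z x ->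
    `|f y - f x| <= L * `|y - x|) ->
  (forall a, X a -> exists2 s : seq (set V), (size s)%:R <= mu &
    forall C, continuity_partition Z f n C ->
      (exists2 y, C y & `|y - a| <= r) -> C \in s) ->
  (forall x, U n x -> exists2 c : seq V, (size c)%:R <= D &
    forall v : V, `|v| <= 1 ->
      exists2 y, y \in c & `|v *m dlin_iter Z f n x - y| <= 2^-1) ->
  (forall B' : set V, (forall x y, B' x -> B' y -> `|x - y| <= r) ->
    coverable (shadowing N delta) b (B' `&` U N)) ->
  (forall x y, B x -> B y -> `|x - y| <= r) ->
  coverable (shadowing (n + N) delta) (mu * (D * b)) (B `&` U (n + N)).
Proof.
move=> n0 L1 r0 Lr mu0 D0 b0 HL Hmu HD IH Br.
(* A point [x0] of the set serves as the centre at which the multiplicity is counted; it lies in [X]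
   because [0 < n]. *)
have [B0|/set0P[x0 [Bx0 Ux0]]] := eqVneq (B `&` U (n + N)) set0.
  by rewrite B0; apply: coverable0; rewrite !mulr_ge0.
have Xx0 : X x0.
  by apply: (@iter_domain_sub _ 0%N _ Ux0); rewrite addn_gt0 n0.
have [s smu Hs] := Hmu _ Xx0.
apply: (coverable_bigcup (s := s)
  (H := fun C => [set x | [/\ B x, U (n + N) x & cylinder n x = C]])) => //.
- by rewrite mulr_ge0.
- move=> C; set G := [set x | _].
  have [G0|/set0P[x1 [Bx1 Ux1 xC1]]] := eqVneq G set0.
    by rewrite G0; apply: coverable0; rewrite mulr_ge0.
  have /iter_domainD[Unx1 _] := Ux1.
  have [c cD Hc] := HD _ Unx1.
  (* Radius [r / 2] gives diameter at most [r], so the induction hypothesis applies again at the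
     same scale. *)
  pose B' y : set V := [set z | `|z - iter n f x1 - r *: y| <= r / 2].
  apply: (coverable_bigcup (s := c)
    (H := fun y => G `&` (iter n f @^-1` B' y))) => //.
  + move=> y.
    have [|t [tb tG tg]] := IH (B' y).
      move=> z w zB wB.
      have -> : z - w = (z - iter n f x1 - r *: y) - (w - iter n f x1 - r *: y).
        by apply/rowP => k; rewrite !mxE; ring.
      apply: le_trans (ler_normB _ _) _.
      by rewrite [leRHS]splitr lerD.
    exists [seq G `&` (iter n f @^-1` A) | A <- t]; split.
    * by rewrite size_map.
    * move=> x [Gx Bx].
      have [|A At Ax] := tG (iter n f x).
        by split=> //; case: Gx => _ /iter_domainD[].
      by exists (G `&` (iter n f @^-1` A)) => //; apply/mapP; exists A.
    * move=> _ /mapP[A At ->] x y' [[Bx Ux xC] Ax] [[By Uy yC] Ay].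
      (* Before time [n] a common cylinder and the Lipschitz bound keep the orbits close; from time
         [n] on, the pulled back set [A] does. *)
      split=> // k kn; case: (ltnP k n) => kn'; last first.
        rewrite -(subnK kn') !iterD.
        by have [_] := tg _ At _ _ Ax Ay; apply; lia.
      have /iter_domainD[Unx _] := Ux.
      have yx : same_itinerary n y' x.
        by have := cylinder_refl Unx; rewrite xC -yC.
      apply: le_trans (iter_lipschitz L1 HL yx (ltnW kn')) _.
      by apply: le_trans Lr; rewrite ler_wpM2l ?Br // exprn_ge0 // (le_trans _ L1).
  + move=> x [Bx Ux xC].
    have /iter_domainD[Unx _] := Ux.
    have x1x : same_itinerary n x1 x.
      by have := cylinder_refl Unx; rewrite xC -xC1.
    (* Rescaling by [r] reduces the trace of [B] to the unit ball, whose linear image is covered at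
       scale 1/2. *)
    have [|y yc Hy] := Hc (r^-1 *: (x - x1)).
      rewrite mx_normZ gtr0_norm ?invr_gt0 // mulrC ler_pdivrMr // mul1r.
      exact: Br.
    exists y => //; split=> //; rewrite /= /B' /=.
    rewrite iter_sub //.
    have -> : (x - x1) *m dlin_iter Z f n x1 - r *: y =
        r *: ((r^-1 *: (x - x1)) *m dlin_iter Z f n x1 - y).
      by rewrite scalerBr -scalemxAl scalerA divff ?scale1r // gt_eqF.
    by rewrite mx_normZ gtr0_norm // ler_wpM2l // ltW.
- move=> x [Bx Ux]; exists (cylinder n x) => //.
  have /iter_domainD[Unx _] := Ux.
  apply: Hs; first exact: cylinder_partition.
  by exists x; [exact: cylinder_refl|exact: Br].
Qed.

(** The sharp bound is used for [m] full blocks and the crude one once, for the last [q]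
    iterates. *)
Lemma cover_long (L delta r mu D : R) (K n : nat) :
  (0 < n)%N -> 1 <= L -> 0 < r -> L ^+ n * r <= delta -> 0 <= mu -> 0 <= D ->
  (forall x y, domain Z x -> domain Z y -> piece Z y = piece Z x ->
    `|f y - f x| <= L * `|y - x|) ->
  (forall q, exists2 s : seq (set V),
    (size s <= K ^ q)%N & continuity_partition Z f q `<=` [set` s]) ->
  (forall a, X a -> exists2 s : seq (set V), (size s)%:R <= mu &
    forall C, continuity_partition Z f n C ->
      (exists2 y, C y & `|y - a| <= r) -> C \in s) ->
  (forall x, U n x -> exists2 c : seq V, (size c)%:R <= D &
    forall v : V, `|v| <= 1 ->
      exists2 y, y \in c & `|v *m dlin_iter Z f n x - y| <= 2^-1) ->
  forall m q (B : set V), (q <= n)%N ->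
    (forall x y, B x -> B y -> `|x - y| <= r) ->
    coverable (shadowing (m * n + q) delta) ((mu * D) ^+ m * (K ^ q)%:R)
      (B `&` U (m * n + q)).
Proof.
move=> n0 L1 r0 Lr mu0 D0 HL HK Hmu HD m q B qn; elim: m B => [|m IH] B Br.
  by rewrite expr0 mul1r; apply: cover_short Lr HL (HK q) Br.
rewrite mulSn -addnA exprS -!mulrA.
by apply: (cover_step n0 L1 r0 Lr) => //; rewrite mulr_ge0 // exprn_ge0 // mulr_ge0.
Qed.

End Dynamics.

(** * Compactness arguments and the bound on covering numbers *)

Section Topology.
Context {R : realType} {d : nat}.
Local Notation V := 'rV[R]_d.
Implicit Types (X : set V) (Z : set (set V)) (f : V -> V).

Lemma counting_enum (T : choiceType) (A : set T) (b : R) : finite_set A ->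
  (counting A <= b%:E)%E ->
  exists2 s : seq T, (size s)%:R <= b & forall x, A x -> x \in s.
Proof.
move=> fA; rewrite /counting asboolT // lee_fin => Ab.
exists (finmap.enum_fset (fset_set A)) => // x Ax.
by have := in_fset_set fA x; rewrite mem_set.
Qed.

Lemma counting_seq_le (T : choiceType) (s : seq T) :
  (counting [set` s] <= (size s)%:R%:E :> \bar R)%E.
Proof.
have fs := finite_seq s.
rewrite /counting asboolT // lee_fin ler_nat uniq_leq_size ?finmap.fset_uniq //.
by move=> x xs; have := in_fset_set fs x; rewrite xs => /esym/set_mem.
Qed.

Lemma not_closure_far (A : set V) (a : V) : ~ closure A a ->
  exists2 rho : R, 0 < rho & forall y, A y -> rho <= `|y - a|.
Proof.
move=> /existsNP[B /not_implyP[aB /set0P/negP/negPn/eqP AB]].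
have /nbhs_ballP[rho /= rho0 Brho] := aB.
exists rho => // y Ay; rewrite leNgt; apply/negP => ya.
suff : (A `&` B) y by rewrite AB.
by split=> //; apply: Brho; rewrite -ball_normE /= distrC.
Qed.

(** A Lebesgue number argument. The finitely many members of [P] whose closure misses [a] stay at a
    distance [rho] from [a], so a ball of radius [rho / 2] about a point near [a] meets only members
    counted by [mult_at P a]. Compactness makes the radius uniform. *)
Lemma lebesgue_multiplicity X (P : set (set V)) (l : seq (set V)) (mu : R) :
  compact X -> P `<=` [set` l] ->
  (forall a, X a -> (mult_at P a <= mu%:E)%E) ->
  \forall r \near 0^'+, X `<=` [set a | exists2 s : seq (set V),
    (size s)%:R <= mu &
    forall C, P C -> (exists2 y, C y & `|y - a| <= r) -> C \in s].
Proof.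
move=> /compact_near_coveringP cX Pl Pmu; apply: cX => a Xa /=.
have [rho rho0 Hrho] : exists2 rho : R, 0 < rho &
    forall C, C \in l -> ~ closure C a -> forall y, C y -> rho <= `|y - a|.
  elim: l {Pl} => [|C l [rho rho0 Hrho]]; first by exists 1.
  have [aC|/not_closure_far[rho' rho'0 Hrho']] := pselect (closure C a).
    by exists rho => // C'; rewrite inE => /predU1P[-> //|]; exact: Hrho.
  exists (Num.min rho rho') => [|C']; first by rewrite lt_min rho0.
  rewrite inE => /predU1P[-> _ y Cy|C'l aC' y Cy].
    by rewrite ge_min Hrho' ?orbT.
  by rewrite ge_min (Hrho C').
have fS : finite_set [set C | P C /\ closure C a].
  by apply: (@sub_finite_set _ _ [set` l]) => [C [/Pl]//|]; exact: finite_seq.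
have [s smu Hs] := counting_enum fS (Pmu _ Xa).
near=> a' r => /=; exists s => // C PC [y Cy ya'].
apply: Hs; split=> //; apply: contrapT => /(Hrho _ (Pl _ PC))/(_ y Cy).
apply/negP; rewrite -ltNge.
rewrite (le_lt_trans (ler_distD a' _ _)) // [rho]splitr ler_ltD //.
  apply: le_trans ya' _; near: r; apply: nbhs_right_le.
  by rewrite divr_gt0.
rewrite distrC; near: a'; have := @near_ball _ _ a (rho / 2).
rewrite divr_gt0 // => /(_ isT); apply: filterS => b.
by rewrite -ball_normE.
Unshelve. all: by end_near. Qed.

(** Uniform continuity of [dist] on the compact set [X], which reduces every compatible metric to
    the norm. *)
Lemma metric_uniform X (dist : V -> V -> R) (e : R) :
  compact X -> compatible_metric X dist -> 0 < e ->
  \forall delta \near 0^'+, forall x y, X x -> X y ->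
    `|x - y| <= delta -> dist x y < e.
Proof.
move=> /compact_near_coveringP cX cd e0.
(* [X x] is repeated inside the set because the covering form of compactness also ranges over points
   near [X] but outside it. *)
suff : \forall delta \near 0^'+, X `<=` [set x | forall y, X x -> X y ->
    `|x - y| <= delta -> dist x y < e].
  by apply: filterS => delta H x y Xx; exact: (H x Xx y Xx).
apply: cX => x Xx /=.
have /(iffRL (dist_nbhs cd [set y | dist x y < e / 2] Xx)) :
    exists2 e' : R, 0 < e' & forall y, X y -> dist x y < e' ->
    [set y | dist x y < e / 2] y.
  by exists (e / 2) => //; rewrite divr_gt0.
move=> /nbhs_ballP[rho /= rho0 Hrho].
near=> x' delta => y Xx' Xy x'y.
have delta_le : delta <= rho / 2.
  by near: delta; apply: nbhs_right_le; rewrite divr_gt0.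
have xx' : `|x - x'| < rho / 2.
  near: x'; have := @near_ball _ _ x (rho / 2).
  rewrite divr_gt0 // => /(_ isT); apply: filterS => b.
  by rewrite -ball_normE.
apply: le_lt_trans (dist_triangle cd Xx' Xx Xy) _.
rewrite [e]splitr ltrD //.
  rewrite (dist_sym cd) //; apply: Hrho => //; rewrite -ball_normE /=.
  by apply: lt_le_trans xx' _; rewrite ler_pdivrMr // ler_peMr ?ltW // ltr1n.
apply: Hrho => //; rewrite -ball_normE /=.
rewrite (le_lt_trans (ler_distD x' _ _)) // [rho]splitr ltr_leD //.
exact: le_trans x'y delta_le.
Unshelve. all: by end_near. Qed.

Lemma covering_number_le X Z f (dist : V -> V -> R) N (e delta b : R) :
  PAff X Z f -> 0 < e ->
  (forall x y, X x -> X y -> `|x - y| <= delta -> dist x y < e) ->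
  coverable (shadowing Z f N delta) b (iter_domain Z f N) ->
  (covering_number dist Z f N e <= b%:E)%E.
Proof.
move=> fX e0 He [t [tb tU tg]].
(* Empty members are dropped, so that each chosen centre belongs to its member and hence to
   [iter_domain Z f N]. *)
pose cs := [seq xget 0 A | A <- t & `[< A !=set0 >]].
apply: (@le_trans _ _ (counting [set` cs])); last first.
  apply: le_trans (counting_seq_le _) _; rewrite lee_fin; apply: le_trans tb.
  by rewrite size_map size_filter ler_nat count_size.
apply: ereal_inf_lbound; exists [set` cs] => //; split.
  move=> _ /mapP[A + ->]; rewrite mem_filter => /andP[/asboolP[x Ax] At].
  by have [] := tg A At (xget 0 A) x (xgetI _ Ax) Ax.
move=> x Ux; have [A At Ax] := tU x Ux.
have Ac := xgetI 0 Ax.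
exists (xget 0 A).
  by apply/mapP; exists A => //; rewrite mem_filter At andbT; apply/asboolP; exists x.
have [Uc _] := tg A At _ _ Ac Ac.
rewrite /= /dist_iter; apply: bigmax_lt => // k _; apply: He.
- exact: (iter_domain_sub fX Uc).
- exact: (iter_domain_sub fX Ux).
- by have [_] := tg A At _ _ Ac Ax; apply.
Qed.

Lemma covering_number_anti Z f (dist : V -> V -> R) N (e e' : R) : e <= e' ->
  (covering_number dist Z f N e' <= covering_number dist Z f N e)%E.
Proof.
move=> ee'; apply: ereal_inf_le_tmp => _ [C [CU UC] <-]; exists C => //; split=> //.
by move=> x /UC[c Cc cx]; exists c => //=; exact: lt_le_trans ee'.
Qed.

Lemma covering_number_empty Z f (dist : V -> V -> R) N (e : R) :
  iter_domain Z f N = set0 -> (covering_number dist Z f N e <= 0)%E.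
Proof.
move=> U0; apply: ereal_inf_lbound; exists set0; first by rewrite U0; split.
by rewrite /counting asboolT // fset_set0 /=.
Qed.

(** With [n] fixed, [delta] is chosen from [e], then [r] from [delta] and [n]. Finitely many balls
    of radius [r / 2] cover [X], and each is followed through [N %/ n] full blocks. *)
Lemma exponential_cover X Z f (dist : V -> V -> R) (e : R) n (mu D : R) :
  PAff X Z f -> compatible_metric X dist -> 0 < e -> (0 < n)%N ->
  0 <= mu -> 0 <= D ->
  (forall a, X a -> (mult_at (continuity_partition Z f n) a <= mu%:E)%E) ->
  (forall x, iter_domain Z f n x -> exists2 c : seq V, (size c)%:R <= D &
    forall v : V, `|v| <= 1 ->
      exists2 y, y \in c & `|v *m dlin_iter Z f n x - y| <= 2^-1) ->
  exists2 K : R, 0 < K & forall N, (0 < N)%N ->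
    (covering_number dist Z f N e <= (K * (mu * D) ^+ (N %/ n))%:E)%E.
Proof.
move=> fX cd e0 n0 mu0 D0 Hmu HD.
have [L L1 HL] := PAff_lipschitz fX.
have [K HK] := partition_seq fX.
have [l _ Hl] := HK n.
have L0 : 0 < L ^+ n by rewrite exprn_gt0 // (lt_le_trans _ L1).
have [delta [delta0 Hdelta]] : exists delta : R, 0 < delta /\
    forall x y, X x -> X y -> `|x - y| <= delta -> dist x y < e.
  near (0 : R)^'+ => delta; exists delta; split; first by near: delta; exact: nbhs_right_gt.
  by near: delta; exact: (metric_uniform (paff_compact fX) cd e0).
have [r [r0 Lr Hr]] : exists r : R, [/\ 0 < r, L ^+ n * r <= delta &
    X `<=` [set a | exists2 s : seq (set V), (size s)%:R <= mu &
    forall C, continuity_partition Z f n C ->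
      (exists2 y, C y & `|y - a| <= r) -> C \in s]].
  near (0 : R)^'+ => r; exists r; split.
  - by near: r; exact: nbhs_right_gt.
  - rewrite mulrC -ler_pdivlMr //; near: r; apply: nbhs_right_le.
    by rewrite divr_gt0.
  - by near: r; exact: (lebesgue_multiplicity (paff_compact fX) Hl Hmu).
have r20 : 0 < r / 2 by rewrite divr_gt0.
have [s Hs] := compact_seq_cover (paff_compact fX) r20.
(* [K] may be 0; with [K.+1] the power is positive and monotone in the exponent. *)
have HK' q : exists2 s : seq (set V),
    (size s <= K.+1 ^ q)%N & continuity_partition Z f q `<=` [set` s].
  by have [u uK Hu] := HK q; exists u => //; apply: leq_trans uK _;
    case: (q) => // q'; rewrite leq_exp2r.
(* The factors account for the initial balls and for the incomplete block of [N %% n] iterates;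
   neither depends on [N]. *)
exists ((size s).+1%:R * (K.+1 ^ n)%:R) => [|N N0].
  by rewrite mulr_gt0 // ltr0n expn_gt0.
apply: (covering_number_le fX e0 Hdelta).
have b0 : 0 <= (mu * D) ^+ (N %/ n) * (K.+1 ^ (N %% n))%:R.
  by rewrite mulr_ge0 // exprn_ge0 // mulr_ge0.
apply: (@coverable_le _ _ _ ((size s).+1%:R *
    ((mu * D) ^+ (N %/ n) * (K.+1 ^ (N %% n))%:R))).
  rewrite -mulrA ler_wpM2l // mulrC ler_wpM2r ?exprn_ge0 ?mulr_ge0 //.
  by rewrite ler_nat leq_pexp2l // ltnW // ltn_pmod.
apply: (coverable_bigcup (s := s)
   (H := fun c => [set x | `|x - c| <= r / 2] `&` iter_domain Z f N)) => //.
- by rewrite ler_nat.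
- move=> c; rewrite {1 4}(divn_eq N n).
  apply: (cover_long fX n0 L1 r0 Lr mu0 D0 HL HK' Hr HD).
    by rewrite ltnW // ltn_pmod.
  move=> x y /= xc yc.
  by rewrite (le_trans (ler_distD c _ _)) // [leRHS]splitr lerD // distrC.
- move=> x Ux; have [c cs xc] := Hs _ (iter_domain_sub fX Ux N0).
  by exists c.
Unshelve. all: by end_near. Qed.

End Topology.

(** * Upper limits and exponential growth rates in the extended reals *)

Section GrowthRates.
Context {R : realType}.
Implicit Types (u v : (\bar R)^nat) (t : \bar R).

Lemma limn_esup_le u t : (\forall n \near \oo, (u n <= t)%E) ->
  (limn_esup u <= t)%E.
Proof.
move=> ut; apply: (@le_trans _ _ (ereal_sup (u @` [set n | (u n <= t)%E]))).
  by apply: ereal_inf_lbound; exists [set n | (u n <= t)%E].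
by apply: ge_ereal_sup => _ [n ? <-].
Qed.

Lemma limn_esup_ge u t : (\forall n \near \oo, (t <= u n)%E) ->
  (t <= limn_esup u)%E.
Proof.
move=> tu; apply: le_ereal_inf_tmp => _ [W Woo <-].
have [n [Wn tn]] := filter_ex (filterI Woo tu).
by apply: le_trans tn _; apply: ereal_sup_ubound; exists n.
Qed.

Lemma limn_esup_lt u t : (limn_esup u < t)%E ->
  \forall n \near \oo, (u n <= t)%E.
Proof.
move=> /ereal_inf_lt[_ [W Woo <-] /ltW Wt]; apply: filterS Woo => n Wn.
by apply: le_trans Wt; apply: ereal_sup_ubound; exists n.
Qed.

Lemma le_limn_esup u v : (forall n, (u n <= v n)%E) ->
  (limn_esup u <= limn_esup v)%E.
Proof.
move=> uv; apply: le_ereal_inf_tmp => _ [W Woo <-].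
apply: (@le_trans _ _ (ereal_sup (u @` W))).
  by apply: ereal_inf_lbound; exists W.
apply: ge_ereal_sup => _ [n Wn <-]; apply: le_trans (uv n) _.
by apply: ereal_sup_ubound; exists n.
Qed.

(** [lne] is -oo on nonpositive arguments, hence monotone everywhere. *)
Lemma le_lne (x y : \bar R) : (x <= y)%E -> (lne x <= lne y)%E.
Proof.
move=> xy; have [x0|x0] := leP x 0%E; first by rewrite le0_lneNy // leNye.
have y0 := lt_le_trans x0 xy.
by rewrite lee_lne // in_itv /= leey andbT ltW.
Qed.

Lemma lne_growth_le n (x : \bar R) (t : R) : (0 < n)%N ->
  ((n%:R^-1)%:E * lne x <= t%:E)%E -> (x <= (expR (n%:R * t))%:E)%E.
Proof.
move=> n0; rewrite lee_pdivrMl ?ltr0n // -EFinM.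
have [x0 _|] := leP x 0%E; first by apply: le_trans x0 _; rewrite lee_fin expR_ge0.
case: x => [r| |] // r0; rewrite lte_fin in r0.
by rewrite lne_EFin // !lee_fin -ler_expR lnK.
Qed.

(** The constant contributes [ln K / N], which tends to 0, and [N %/ n] is at most [N / n]; [1 <= Q]
    gives [ln Q] the right sign. *)
Lemma growth_quotient (K Q eps : R) n : (0 < n)%N -> 0 < K -> 1 <= Q -> 0 < eps ->
  \forall N \near \oo,
    ((N%:R^-1)%:E * lne (K * Q ^+ (N %/ n))%:E <= (n%:R^-1 * ln Q + eps)%:E)%E.
Proof.
move=> n0 K0 Q1 e0.
have Q0 : 0 < Q by rewrite (lt_le_trans _ Q1).
near=> N.
have N0 : (0 < N)%N by near: N; exact: nbhs_infty_gt.
have NR : 0 < N%:R :> R by rewrite ltr0n.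
have NK : ln K <= eps * N%:R.
  rewrite mulrC -ler_pdivrMr //; near: N; exact: nbhs_infty_ger.
rewrite lne_EFin ?mulr_gt0 ?exprn_gt0 // -EFinM lee_fin.
rewrite lnM ?posrE ?exprn_gt0 // lnXn // ler_pdivrMl //.
rewrite mulrDr addrC lerD //; last by rewrite mulrC.
rewrite -[ln Q *+ _]mulr_natl mulrA ler_wpM2r ?ln_ge0 //.
by rewrite ler_pdivlMr ?ltr0n // -natrM ler_nat leq_divM.
Unshelve. all: by end_near. Qed.

End GrowthRates.

(** * The entropy inequality *)

Section Entropy.
Context {R : realType} {d : nat}.
Local Notation V := 'rV[R]_d.
Variables (X : set V) (Z : set (set V)) (f : V -> V) (dist : V -> V -> R).
Hypothesis fX : PAff X Z f.

(** Covering numbers grow as [e] decreases, so the limit at 0 exists and inherits a bound valid for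
    every [e]. *)
Lemma htop_le (t : \bar R) :
  (forall e : R, 0 < e -> (limn_esup (fun n =>
     (n%:R^-1)%:E * lne (covering_number dist Z f n e)) <= t)%E) ->
  (htop dist Z f <= t)%E.
Proof.
move=> ht; apply: lime_le; last first.
  near=> e; apply: ht; near: e; exact: nbhs_right_gt.
apply: cvgP; apply: (nonincreasing_at_right_cvge (BInfty _ false)) => //.
move=> e e' _ _ ee'; apply: le_limn_esup => n.
apply: lee_wpmul2l; first by rewrite lee_fin invr_ge0.
exact/le_lne/covering_number_anti.
Unshelve. all: by end_near. Qed.

Lemma htop_empty n : iter_domain Z f n = set0 -> htop dist Z f = -oo%E.
Proof.
move=> Un0; apply/eqP; rewrite -leeNy_eq; apply: htop_le => e e0.
apply: limn_esup_le; near=> N.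
have nN : (n <= N)%N by near: N; exact: nbhs_infty_ge.
have N0 : (0 < N)%N by near: N; exact: nbhs_infty_gt.
have UN0 : iter_domain Z f N = set0.
  rewrite -subset0 => x; rewrite -(subnKC nN) => /iter_domainD[].
  by rewrite Un0.
rewrite le0_lneNy ?covering_number_empty //.
by rewrite gt0_muleNy // lte_fin invr_gt0 ltr0n.
Unshelve. all: by end_near. Qed.

(** The exterior power of degree 0 already contributes a nonnegative logarithm. *)
Lemma expansion_rate_ge0 : (forall n, iter_domain Z f n !=set0) ->
  (0 <= expansion_rate Z f)%E.
Proof.
move=> U0; apply: limn_esup_ge; near=> n.
have [x Ux] := U0 n; apply: le_ereal_sup_tmp.
eexists; first by exists x.
apply: mule_ge0; first by rewrite lee_fin invr_ge0.
apply: (le_trans _ (le_bigmax _ _ ord0)).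
by rewrite lne_ge0 lee_fin opnorm_extpow0.
Unshelve. all: by end_near. Qed.

(** A point of [U_n] lies in the closure of its own cylinder, so the multiplicity is at least 1. *)
Lemma Hmult_ge0 : (forall n, iter_domain Z f n !=set0) -> (0 <= Hmult X Z f)%E.
Proof.
move=> U0; apply: limn_esup_ge; near=> n.
have n0 : (0 < n)%N by near: n; exact: nbhs_infty_gt.
have [x Ux] := U0 n.
apply: mule_ge0; first by rewrite lee_fin invr_ge0.
rewrite lne_ge0; apply: (@le_trans _ _ (mult_at (continuity_partition Z f n) x)).
  rewrite /mult_at /counting; case: ifPn => [/asboolP fS|_]; last exact: leey.
  rewrite lee_fin ler1n lt0n size_eq0; apply/eqP => S0.
  have := in_fset_set fS (cylinder Z f n x).
  rewrite mem_set ?[LHS]inE ?S0 //; split; first exact: (cylinder_partition fX).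
  exact/subset_closure/cylinder_refl.
apply: ereal_sup_ubound; exists x => //.
exact: (iter_domain_sub fX Ux n0).
Unshelve. all: by end_near. Qed.

Lemma limn_esup_covering (lam eta eps e : R) :
  compatible_metric X dist -> (forall n, iter_domain Z f n !=set0) ->
  expansion_rate Z f = lam%:E -> Hmult X Z f = eta%:E -> 0 < eps -> 0 < e ->
  (limn_esup (fun n => (n%:R^-1)%:E * lne (covering_number dist Z f n e))
   <= (lam + eta + eps)%:E)%E.
Proof.
move=> cd U0 lamE etaE eps0 e0.
(* One quarter of [eps] each for the expansion rate, the multiplicity, the constant [C] and the
   passage to the limit in [N]. *)
pose h := eps / 4; have h0 : 0 < h by rewrite divr_gt0.
(* Nonnegative rates make [mu] and [E] at least 1, as [growth_quotient] will require of their
   product with [C]. *)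
have lam0 : 0 <= lam by rewrite -lee_fin -lamE expansion_rate_ge0.
have eta0 : 0 <= eta by rewrite -lee_fin -etaE Hmult_ge0.
have [C C1 HC] := @minor_cover R d 2^-1 ltac:(by rewrite invr_gt0).
have /limn_esup_lt lam_near : (expansion_rate Z f < (lam + h)%:E)%E.
  by rewrite lamE lte_fin ltrDl.
have /limn_esup_lt eta_near : (Hmult X Z f < (eta + h)%:E)%E.
  by rewrite etaE lte_fin ltrDl.
(* The block length [n] is fixed here, large enough for both rates and for [ln C / n]; only
   afterwards does [N] tend to infinity. *)
near \oo => n.
have n0 : (0 < n)%N by near: n; exact: nbhs_infty_gt.
have nR : 0 < n%:R :> R by rewrite ltr0n.
have nC : n%:R^-1 * ln C <= h.
  rewrite ler_pdivrMl // mulrC -ler_pdivrMl // mulrC; near: n; exact: nbhs_infty_ger.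
pose mu := expR (n%:R * (eta + h)); pose E := expR (n%:R * (lam + h)).
have mu1 : 1 <= mu by rewrite -expR0 ler_expR mulr_ge0 // addr_ge0 // ltW.
have E1 : 1 <= E by rewrite -expR0 ler_expR mulr_ge0 // addr_ge0 // ltW.
have Hmu a : X a -> (mult_at (continuity_partition Z f n) a <= mu%:E)%E.
  move=> Xa; apply: (@le_trans _ _ (mult X (continuity_partition Z f n))).
    by apply: ereal_sup_ubound; exists a.
  by apply: lne_growth_le => //; near: n; exact: eta_near.
(* All degrees are bounded at once because the size of the minor found by [minor_cover] varies with
   [x]. *)
have HE x k : iter_domain Z f n x -> (k <= d)%N ->
    opnorm (extpow k (dlin_iter Z f n x)) <= E.
  move=> Ux kd; rewrite -lee_fin; apply: lne_growth_le => //.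
  have : (ereal_sup [set (n%:R^-1)%:E *
         \big[maxe/-oo]_(k < d.+1) lne (opnorm (extpow k (dlin_iter Z f n x)))%:E
    | x in iter_domain Z f n] <= (lam + h)%:E)%E by near: n; exact: lam_near.
  apply: le_trans; apply: le_ereal_sup_tmp.
  eexists; first by exists x.
  apply: lee_wpmul2l; first by rewrite lee_fin invr_ge0.
  exact: (le_bigmax _
    (fun k : 'I_d.+1 => lne (opnorm (extpow k (dlin_iter Z f n x)))%:E)
    (Ordinal (kd : (k < d.+1)%N))).
have HD x : iter_domain Z f n x -> exists2 c : seq V, (size c)%:R <= C * E &
    forall v : V, `|v| <= 1 ->
      exists2 y, y \in c & `|v *m dlin_iter Z f n x - y| <= 2^-1.
  move=> Ux; have [k [s [t [c [kd D1 cD Hc]]]]] := HC (dlin_iter Z f n x).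
  exists c => //; apply: le_trans cD _; rewrite ler_wpM2l ?(le_trans _ C1) //.
  apply: le_trans (HE _ _ Ux kd); apply: minor_le_opnorm.
  by rewrite -normr_gt0 (lt_le_trans _ D1).
have C0 : 0 < C by rewrite (lt_le_trans _ C1).
have [K K0 HK] := exponential_cover fX cd e0 n0 (le_trans ler01 mu1)
  (mulr_ge0 (ltW C0) (le_trans ler01 E1)) Hmu HD.
have Q1 : 1 <= mu * (C * E) by rewrite !mulr_ege1.
have lnQ : n%:R^-1 * ln (mu * (C * E)) <= lam + eta + 3 * h.
  rewrite !lnM ?posrE ?mulr_gt0 ?expR_gt0 // !expRK !mulrDr.
  rewrite ![_^-1 * (n%:R * _)]mulrA mulVf ?gt_eqF // !mul1r.
  lra.
apply: limn_esup_le.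
have := growth_quotient n0 K0 Q1 h0; apply: filterS2 (nbhs_infty_gt 0) => N N0 HN.
apply: (@le_trans _ _ ((N%:R^-1)%:E * lne (K * (mu * (C * E)) ^+ (N %/ n))%:E)%E).
  by apply: lee_wpmul2l; [rewrite lee_fin invr_ge0|exact/le_lne/HK].
apply: le_trans HN _; rewrite lee_fin.
have -> : eps = 4 * h by rewrite /h; field.
by lra.
Unshelve. all: by end_near. Qed.

End Entropy.

Local Open Scope ereal_scope.

Theorem theorem1 (R : realType) (d : nat) (X : set 'rV[R]_d)
  (Z : set (set 'rV[R]_d)) (f : 'rV[R]_d -> 'rV[R]_d)
  (dist : 'rV[R]_d -> 'rV[R]_d -> R) :
  PAff X Z f -> compatible_metric X dist ->
  htop dist Z f <= expansion_rate Z f + Hmult X Z f.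
Proof.
move=> fX cd.
have [U0|/existsNP[n /set0P/negP/negPn/eqP Un0]] :=
    pselect (forall n, iter_domain Z f n !=set0); last first.
  (* Without orbits of length [n] the entropy is -oo. *)
  by rewrite (htop_empty _ Un0) leNye.
(* Nonnegativity excludes -oo for both rates, so the right-hand side is either +oo or a sum of two
   reals. *)
have := expansion_rate_ge0 U0; have := Hmult_ge0 fX U0.
case Elam : (expansion_rate Z f) => [lam| |] //; last first.
  by case: (Hmult X Z f) => // [r|] _ _; rewrite leey.
case Eeta : (Hmult X Z f) => [eta| |] // _ _; last by rewrite leey.
apply: htop_le => e e0; apply/lee_addgt0Pr => eps eps0.
by rewrite -!EFinD; apply: (limn_esup_covering fX).
Qed.
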